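(* $L\star\delta_\bullet=\log^*\delta$ as linear forms on $\mathcal H_{CK}$.
   Context: Let $k$ be a field of characteristic $0$. Rooted trees are finite and non-planar; $\bullet$ is the one-vertex tree; $B_+(t_1\cdots t_n)$ is the tree obtained by joining the roots of $t_1,\dots,t_n$ to a new root. The tree factorial is defined by $\bullet!=1$ and $B_+(t_1\cdots t_n)!=v(B_+(t_1\cdots t_n))\prod_j t_j!$, $v$ = number of vertices. (1) $\mathcal H$ is the free commutative $k$-algebra generated by isomorphism classes of rooted trees with at least one edge, with unit identified with $\bullet$. A subforest of a rooted tree $t$ is either the trivial subforest $\bullet$ or a nonempty set of pairwise vertex-disjoint subtrees each with at least one edge, identified with the product of its components; $t/s$ is the tree obtained by contracting each component of $s$ to a vertex. $\mathcal H$ is a Hopf algebra with multiplicative coproduct $\Delta(t)=\sum_s s\otimes t/s$ over subforests (as subsets) and antipode $S$; $E$ is the character of $\mathcal H$ with $E(t)=1/t!$ for each tree $t$ with at least one edge, and $L=E\circ S$ is its inverse for the convolution $f\star g=(f\otimes g)\circ\Delta$. (2) $\mathcal H_{CK}$ is the Connes–Kreimer Hopf algebra of rooted forests (unit empty forest $\mathbf 1$, counit $\varepsilon$, coproduct by admissible cuts $\Delta_{CK}(u)=\sum v\otimes w$ over decompositions of the vertex set of $u$ into $V\sqcup W$ with no vertex of $V$ strictly below a vertex of $W$), with convolution $*$. $\delta$ is the character of $\mathcal H_{CK}$ with $\delta(\bullet)=1$ and $\delta(t)=0$ for trees with at least two vertices; $\log^*\delta=\sum_{n\ge1}\frac{(-1)^{n+1}}{n}(\delta-\varepsilon)^{*n}$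 (a locally finite sum). $\delta_\bullet$ takes value $1$ on the tree $\bullet$ and $0$ on all other forests. (3) $\Phi:\mathcal H_{CK}\to\mathcal H\otimes\mathcal H_{CK}$ is the algebra morphism with $\Phi(\mathbf 1)=\bullet\otimes\mathbf 1$ and $\Phi(t)=\sum_s s\otimes t/s$ over subforests of $t$ for each nonempty tree; $L\star\delta_\bullet:=(L\otimes\delta_\bullet)\circ\Phi$. *)

(* Defs.v *)
From HB Require Import structures.
From mathcomp Require Import all_boot all_order all_algebra.
Set Implicit Arguments. Unset Strict Implicit. Unset Printing Implicit Defensive.
Import Order.TTheory GRing.Theory Num.Theory.

(* A rooted tree is given by the list of its root's subtrees; isomorphism
   classes of (non-planar) rooted trees are represented by any planar
   representative.  A forest of H_CK is a list of trees (empty list = unit). *)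
Inductive tree := Node of seq tree.
Definition forest := seq tree.

Definition bullet : tree := Node [::].
Definition is_bullet (t : tree) : bool :=
  match t with Node [::] => true | _ => false end.

Fixpoint nv (t : tree) : nat :=
  match t with Node cs => (sumn (map nv cs)).+1 end.
Definition nedges (t : tree) : nat := (nv t).-1.
Definition nvf (u : forest) : nat := sumn (map nv u).

Fixpoint tfact (t : tree) : nat :=
  match t with Node cs => nv (Node cs) * foldr muln 1 (map tfact cs) end.

Fixpoint cprod (A : Type) (ss : seq (seq A)) : seq (seq A) :=
  match ss with
  | [::] => [:: [::]]
  | s :: ss' => [seq x :: l | x <- s, l <- cprod ss']
  end.

(* A tree whose every edge (from a vertex to a child) carries a boolean:
   true = the edge belongs to the chosen edge subset A. *)
Inductive btree := BNode of seq (bool * btree).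

Fixpoint edecs (t : tree) : seq btree :=
  match t with
  | Node cs => [seq BNode l | l <- cprod
        [seq [seq (b, d) | b <- [:: true; false], d <- edecs c] | c <- cs]]
  end.

Fixpoint full (A : btree) : bool :=
  match A with BNode cs => all (fun bc => bc.1 && full bc.2) cs end.

Fixpoint mtree (A : btree) : tree :=
  match A with
  | BNode cs => Node (flatten [seq (if bc.1 then [:: mtree bc.2] else [::]) | bc <- cs])
  end.

(* the connected components (each with >= 1 edge) of the edge set A:
   this is the subforest s of t determined by A (empty list = trivial
   subforest bullet). [top] says whether the current vertex is not joined
   to its parent by a marked edge. *)
Fixpoint comps (top : bool) (A : btree) : seq tree :=
  match A with
  | BNode cs =>
      (if top && has fst cs then [:: mtree (BNode cs)] else [::])
      ++ flatten [seq comps (~~ bc.1) bc.2 | bc <- cs]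
  end.
Definition subforest (A : btree) : seq tree := comps true A.

(* contraction t/s: contract every marked edge; [contk] returns the list of
   children of the (contracted) root *)
Fixpoint contk (A : btree) : seq tree :=
  match A with
  | BNode cs => flatten [seq (if bc.1 then contk bc.2 else [:: Node (contk bc.2)]) | bc <- cs]
  end.
Definition quot (A : btree) : tree := Node (contk A).

Inductive vtree := VNode of bool & seq vtree.
Definition vmark (D : vtree) : bool := let: VNode b _ := D in b.

Fixpoint vdecs (t : tree) : seq vtree :=
  match t with
  | Node cs => [seq VNode b l | b <- [:: true; false], l <- cprod (map vdecs cs)]
  end.

Fixpoint kidsV (p : bool) (D : vtree) : seq tree :=
  match D with
  | VNode _ cs => flatten [seq (if vmark c == p then [:: Node (kidsV p c)] else [::]) | c <- cs]
  end.

Fixpoint indf (p top : bool) (D : vtree) : seq tree :=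
  match D with
  | VNode b cs =>
      (if top && (b == p) then [:: Node (kidsV p (VNode b cs))] else [::])
      ++ flatten [seq indf p (b != p) c | c <- cs]
  end.

Fixpoint allin (p : bool) (D : vtree) : bool :=
  match D with VNode b cs => (b == p) && all (allin p) cs end.

(* admissibility of V (= vertices marked true), W = complement:
   no vertex of V strictly below (= a strict ancestor of) a vertex of W,
   i.e. V is closed under taking descendants. *)
Fixpoint adm (D : vtree) : bool :=
  match D with VNode b cs => (b ==> all (allin true) cs) && all adm cs end.

Section Forms.
Variable k : fieldType.
Local Open Scope ring_scope.

Definition Echar (t : tree) : k := ((tfact t)%:R)^-1.

(* L = E o S computed through the antipode recursion
   S(t) = - sum_{s subforest, s <> t} S(s) (t/s), t with >= 1 edge,
   E multiplicative; fuel n only guarantees termination (n > #edges). *)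
Fixpoint Lf (n : nat) (t : tree) : k :=
  match n with
  | 0 => 1
  | n'.+1 =>
      if nedges t == 0%N then 1 else
      - \sum_(A <- edecs t | ~~ full A)
          (\prod_(c <- subforest A) Lf n' c) * Echar (quot A)
  end.
Definition Lchar (t : tree) : k := Lf (nv t) t.

Definition delta_bullet (u : forest) : k :=
  match u with [:: Node [::]] => 1 | _ => 0 end.

(* (L (x) delta_bullet) o Phi, Phi the algebra morphism with
   Phi(t) = sum_s s (x) t/s; on a forest t1...tn this is the sum over all
   tuples of subforests (s1,...,sn). *)
Definition L_star_delta_bullet (u : forest) : k :=
  \sum_(As <- cprod (map edecs u))
     (\prod_(A <- As) \prod_(c <- subforest A) Lchar c)
     * delta_bullet (map quot As).

Definition epsCK (u : forest) : k := (nilp u)%:R.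
Definition deltaCK (u : forest) : k := (all is_bullet u)%:R.

Definition convCK (f g : forest -> k) (u : forest) : k :=
  \sum_(D <- cprod (map vdecs u) | all adm D)
     f (flatten (map (indf true true) D)) * g (flatten (map (indf false true) D)).

Fixpoint cpow (f : forest -> k) (n : nat) : forest -> k :=
  match n with
  | 0 => epsCK
  | n'.+1 => convCK (cpow f n') f
  end.

Definition log_delta_partial (N : nat) (u : forest) : k :=
  \sum_(1 <= n < N.+1)
     ((-1) ^+ n.+1 / n%:R) * cpow (fun v => deltaCK v - epsCK v) n u.

End Forms.

(* Main.v *)
(* Let Om_t be the strict order polynomial of t, extended multiplicatively to
   forests.  Convolution by delta sends u |-> Om_u(x) to u |-> Om_u(x + 1), so
   (delta - eps)^{*n}(u) is the n-th finite difference of Om_u at 0, and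
   log^* delta (u) = Om_u'(0) because d/dx = log (1 + difference operator).
   Put ell(t) = Om_t'(0), extended multiplicatively.  A Vandermonde identity for
   Om shows that Om_t(x) and sum_s ell(s) x^{v(t/s)} / (t/s)! satisfy the same
   differential recursion, hence agree; at x = 1 this says that ell satisfies
   the antipode recursion defining L = E o S.  So L(t) = Om_t'(0), and both
   forms vanish on products since Om_t(0) = 0. *)
Require Import Defs.
From HB Require Import structures.
From mathcomp Require Import all_boot all_order all_algebra ring.
From Stdlib Require List.
Import GRing.Theory.
Local Open Scope ring_scope.
Set Implicit Arguments.
Unset Strict Implicit.
Unset Printing Implicit Defensive.

(** * Finite differences and the Newton basis in characteristic 0 *)

Section FiniteDifferences.
Variables (k : fieldType) (hk : [pchar k] =i pred0).
Implicit Types (p q : {poly k}) (n N : nat).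

Lemma natr_neq0 n : (n.+1)%:R != 0 :> k.
Proof. by rewrite (iffLR (pcharf0P k) hk). Qed.

Lemma natr_inj : injective (fun n : nat => n%:R : k).
Proof.
suff le m n : m%:R = n%:R :> k -> (m <= n)%N.
  by move=> m n e; apply/eqP; rewrite eqn_leq !le.
move=> e; rewrite leqNgt; apply/negP => /subnKC def_m.
move: e; rewrite -def_m addSnnS natrD => /eqP.
by rewrite -subr_eq0 addrC addKr (negPf (natr_neq0 _)).
Qed.

Lemma poly0_of_natr_roots p : (forall n, p.[n%:R] = 0) -> p = 0.
Proof.
move=> p0; apply/eqP/idPn => pn0.
have := @max_poly_roots k p [seq n%:R | n <- iota 0 (size p)] pn0.
rewrite size_map size_iota ltnn; case/(_ _ _)/Bool.diff_false_true => //.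
  by apply/allP => _ /mapP[n _ ->]; rewrite rootE p0.
by rewrite map_inj_uniq ?iota_uniq //; apply: natr_inj.
Qed.

Lemma poly_inj_horner p q : (forall a, p.[a] = q.[a]) -> p = q.
Proof.
move=> e; apply/eqP; rewrite -subr_eq0; apply/eqP/poly0_of_natr_roots => n.
by rewrite !hornerE e subrr.
Qed.

Lemma deriv_inj p q : p^`() = q^`() -> p.[0] = q.[0] -> p = q.
Proof.
move=> e e0; apply/polyP => -[|i]; first by rewrite -!horner_coef0.
have := congr1 (fun r : {poly k} => r`_i) e; rewrite !coef_deriv => ei.
by apply: (mulIf (natr_neq0 i)); rewrite !mulr_natr.
Qed.

Definition dif p : {poly k} := p \Po ('X + 1) - p.

Lemma dif_is_linear : linear dif.
Proof.
by move=> a p q; rewrite /dif linearP /= scalerBr; ring.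
Qed.
HB.instance Definition _ :=
  GRing.isLinear.Build k {poly k} {poly k} _ dif dif_is_linear.

Lemma difZ a p : dif (a *: p) = a *: dif p.
Proof. exact: linearZ. Qed.

Lemma difD p q : dif (p + q) = dif p + dif q.
Proof. exact: linearD. Qed.

Lemma dif_sum (I : Type) (s : seq I) (F : I -> {poly k}) :
  dif (\sum_(i <- s) F i) = \sum_(i <- s) dif (F i).
Proof. exact: linear_sum. Qed.

Lemma difC a : dif a%:P = 0.
Proof. by rewrite /dif comp_polyC subrr. Qed.

Lemma dif1 : dif 1 = 0.
Proof. by rewrite /dif rmorph1 subrr. Qed.

Lemma horner_dif p a : (dif p).[a] = p.[a + 1] - p.[a].
Proof. by rewrite /dif !hornerE horner_comp !hornerE. Qed.

(** By induction the values agree at every natural number, and in characteristic 0 these are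
    infinitely many points. *)
Lemma dif0_inj p q : dif p = dif q -> p.[0] = q.[0] -> p = q.
Proof.
move=> e e0; apply/eqP; rewrite -subr_eq0; apply/eqP.
apply: poly0_of_natr_roots; elim=> [|n IH]; first by rewrite !hornerE e0 subrr.
have := congr1 (fun r => r.[n%:R]) e; rewrite !horner_dif natr1 => /eqP.
rewrite -subr_eq0 => /eqP d0; move: IH; rewrite !hornerE => IH.
rewrite -[LHS]subr0 -[X in _ - X]IH -[RHS]d0; ring.
Qed.

Lemma size_dif p : (size (dif p) <= (size p).-1)%N.
Proof.
have sX : size ('X + 1 : {poly k}) = 2 by rewrite -[1]opprK -[- 1]polyCN size_XsubC.
have lX : lead_coef ('X + 1 : {poly k}) = 1.
  by rewrite -[1 in LHS]opprK -[- 1]polyCN lead_coefXsubC.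
have sc := size_comp_poly2 p sX.
have := lead_coef_comp p (_ : (1 < size ('X + 1 : {poly k})%R)%N).
rewrite sX lX expr1n mulr1 !lead_coefE sc => /(_ isT) lc.
apply/leq_sizeP => j; rewrite leq_eqVlt coefB => /predU1P[<-|lt_j].
  by rewrite lc subrr.
have le_j : (size p <= j)%N by case: (size p) lt_j.
by rewrite !nth_default ?subrr ?sc.
Qed.

(** The binomial polynomial ['X] choose [n]. *)
Definition newton n : {poly k} :=
  (n`!%:R)^-1 *: \prod_(i < n) ('X - i%:R%:P).

(** Pascal's rule: after the shift both products share a falling factorial of length [n], and the
    remaining factors ['X + 1] and ['X - n] differ by [n + 1]. *)
Lemma dif_newton n : dif (newton n.+1) = newton n.
Proof.
rewrite linearZ /= /dif rmorph_prod /=.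
rewrite big_ord_recl /= [X in _ - X]big_ord_recr /=.
have -> : \prod_(i < n) (('X - (lift ord0 i)%:R%:P) \Po ('X + 1))
   = \prod_(i < n) ('X - i%:R%:P) :> {poly k}.
  apply: eq_bigr => i _; rewrite rmorphB /= comp_polyX comp_polyC /bump /=.
  by rewrite natrD polyCD; ring.
rewrite rmorphB /= comp_polyX comp_polyC /newton.
have -> (r : {poly k}) : ('X + 1 - 0%:R%:P) * r - r * ('X - n%:R%:P)
  = (n.+1)%:R *: r.
  by rewrite -mul_polyC -natr1 !rmorphD /=; ring.
rewrite scalerA; congr (_ *: _).
by rewrite factS natrM invfM mulrC mulrA mulfV ?natr_neq0 // mul1r.
Qed.

Lemma newton0 : newton 0 = 1.
Proof. by rewrite /newton big_ord0 fact0 invr1 scale1r. Qed.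

Lemma newton_at0 n : (newton n).[0] = (n == 0)%:R.
Proof.
case: n => [|n]; first by rewrite newton0 hornerC.
by rewrite /newton big_ord_recl subr0 hornerZ hornerM hornerX mul0r mulr0.
Qed.

Lemma size_newton n : (size (newton n) <= n.+1)%N.
Proof.
apply: (leq_trans (size_scale_leq _ _)).
by rewrite size_prod_XsubC /index_enum -enumT size_enum_ord.
Qed.

(** Only the term differentiating the factor ['X] survives at 0; the other factors give
    (-1)(-2)...(-n). *)
Lemma deriv_newton_at0 n : (newton n.+1)^`().[0] = (-1) ^+ n / (n.+1)%:R.
Proof.
rewrite /newton derivZ big_ord_recl /= subr0 derivM derivX mul1r.
rewrite hornerZ hornerD hornerM hornerX mul0r addr0 horner_prod.
rewrite factS natrM invfM mulrAC [RHS]mulrC -mulrA; congr (_ * _).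
rewrite (eq_bigr (fun i : 'I_n => (-1) * (i.+1)%:R : k)); last first.
  by move=> i _; rewrite hornerXsubC /bump /= sub0r mulN1r.
rewrite big_split /= prodr_const card_ord -natr_prod.
have -> : (\prod_(i < n) i.+1 = n`!)%N by rewrite fact_prod big_add1 big_mkord.
apply: mulfK.
by case: n`! (fact_gt0 n) => // m _; apply: natr_neq0.
Qed.

Lemma newton_expansion N p : (size p <= N)%N ->
  p = \sum_(n < N) (iter n dif p).[0] *: newton n.
Proof.
elim: N p => [|N IH] p sp.
  by rewrite big_ord0; apply/eqP; rewrite -size_poly_eq0 -leqn0.
apply: dif0_inj.
  rewrite big_ord_recl linearD /= linear_sum /=.
  rewrite newton0 difZ dif1 scaler0 add0r.
  rewrite {1}(IH (dif p)); last first.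
    by rewrite (leq_trans (size_dif p)) //; case: (size p) sp.
  by apply: eq_bigr => i _; rewrite /bump add1n difZ dif_newton add0n -iterS iterSr.
rewrite horner_sum big_ord_recl big1 => [|i _].
  by rewrite addr0 hornerZ newton_at0 mulr1.
by rewrite hornerZ newton_at0 mulr0.
Qed.

(** Indefinite summation: the Newton expansion of [p] with each basis index raised by one. *)
Definition sumop p : {poly k} :=
  \sum_(n < size p) (iter n dif p).[0] *: newton n.+1.

Lemma dif_sumop p : dif (sumop p) = p.
Proof.
rewrite linear_sum /= [RHS](@newton_expansion (size p) p) //.
by apply: eq_bigr => n _; rewrite difZ dif_newton.
Qed.

Lemma sumop_at0 p : (sumop p).[0] = 0.
Proof.
by rewrite horner_sum big1 // => n _; rewrite hornerZ newton_at0 mulr0.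
Qed.

Lemma size_sumop p : (size (sumop p) <= (size p).+1)%N.
Proof.
apply: (leq_trans (size_sum _ _ _)); apply/bigmax_leqP => n _.
apply: leq_trans (size_scale_leq _ _) (leq_trans (size_newton _) _).
exact: ltn_ord.
Qed.

(* The identity d/dx = log (1 + dif), read off on the Newton basis. *)
Lemma deriv0_log_dif N p : (size p <= N.+1)%N ->
  p^`().[0] =
    \sum_(1 <= n < N.+1) (-1) ^+ n.+1 / n%:R * (iter n dif p).[0].
Proof.
move=> sp; rewrite {1}(newton_expansion sp) linear_sum /= horner_sum.
rewrite big_ord_recl /= big_add1 /= big_mkord.
rewrite newton0 derivZ derivC scaler0 horner0 add0r.
apply: eq_bigr => n _; rewrite /bump add1n derivZ hornerZ deriv_newton_at0.
by rewrite mulrC !exprS !mulN1r opprK.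
Qed.

End FiniteDifferences.

(** * Sums over lists of choices, one per child *)

Section Choices.
Variable R : comNzRingType.

Lemma eq_big_In (S I : Type) (idx : S) (op : S -> S -> S) (s : seq I) (F G : I -> S) :
  (forall i, List.In i s -> F i = G i) ->
  \big[op/idx]_(i <- s) F i = \big[op/idx]_(i <- s) G i.
Proof.
elim: s => [|x s IH] FG; rewrite ?big_nil // !big_cons FG; last by left.
by rewrite IH // => i si; apply: FG; right.
Qed.

Lemma eq_big_all (I : Type) (a : pred I) (s : seq I) (P : pred I) (F G : I -> R) :
  all a s -> (forall i, a i -> P i -> F i = G i) ->
  \sum_(i <- s | P i) F i = \sum_(i <- s | P i) G i.
Proof.
move=> + FG; elim: s => [|x s IH]; rewrite ?big_nil //= => /andP[ax /IH e].
by rewrite !big_cons e; case: ifP => // Px; rewrite FG.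
Qed.

Lemma big_cprod (A : Type) (f : A -> R) (ss : seq (seq A)) :
  \sum_(l <- cprod ss) \prod_(x <- l) f x = \prod_(s <- ss) \sum_(x <- s) f x.
Proof.
elim: ss => [|s ss IH] /=; first by rewrite big_seq1 !big_nil.
rewrite big_allpairs_dep big_cons mulr_suml; apply: eq_bigr => x _.
by rewrite -IH mulr_sumr; apply: eq_bigr => l _; rewrite big_cons.
Qed.

(** Passes from single children to the whole list. Quantifying over the test function [F] lets the
    induction absorb the prefix contributed by earlier children. *)
Lemma cprod_transfer (I A B C : Type) (cs : seq I)
    (S : I -> seq A) (f : A -> seq C) (g : A -> R)
    (S' : I -> seq B) (f' : B -> seq C) (g' : B -> R) :
  (forall c, List.In c cs -> forall F : seq C -> R,
     \sum_(x <- S c) F (f x) * g x = \sum_(y <- S' c) F (f' y) * g' y) ->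
  forall F : seq C -> R,
  \sum_(l <- cprod (map S cs)) F (flatten (map f l)) * \prod_(x <- l) g x =
  \sum_(l <- cprod (map S' cs)) F (flatten (map f' l)) * \prod_(y <- l) g' y.
Proof.
elim: cs => [|c cs IH] eqS F /=; first by rewrite !big_seq1 /= !big_nil.
rewrite !big_allpairs_dep /=.
have split_head (D : Type) (h : D -> seq C) (m : D -> R) x ls :
  \sum_(l <- ls) F (flatten (map h (x :: l))) * \prod_(y <- x :: l) m y =
  (\sum_(l <- ls) F (h x ++ flatten (map h l)) * \prod_(y <- l) m y) * m x.
  by rewrite mulr_suml; apply: eq_bigr => l _; rewrite big_cons -mulrA [m x * _]mulrC.
under eq_bigr => x _ do rewrite split_head.
under [RHS]eq_bigr => y _ do rewrite split_head.
have {}IH z := IH (fun c' h => eqS c' (or_intror h)) (fun w => F (z ++ w)).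
under eq_bigr => x _ do rewrite IH.
exact: (eqS c (or_introl erefl) (fun z => \sum_(l <- cprod (map S' cs))
  F (z ++ flatten (map f' l)) * \prod_(y <- l) g' y)).
Qed.

Lemma filter_all_cprod (A : Type) (a : pred A) (ss : seq (seq A)) :
  filter (all a) (cprod ss) = cprod (map (filter a) ss).
Proof.
elim: ss => //= s ss <-; elim: s => //= x s IH; rewrite filter_cat IH.
rewrite filter_map; case: (boolP (a x)) => ax /=.
  by congr (map _ _ ++ _); apply: eq_filter => l /=; rewrite ax.
by rewrite (eq_filter (a2 := pred0)) ?filter_pred0 // => l /=; rewrite (negPf ax).
Qed.

Lemma cprod_seq1 (I A : Type) (f : I -> A) (cs : seq I) :
  cprod [seq [:: f c] | c <- cs] = [:: map f cs].
Proof. by elim: cs => //= c cs ->. Qed.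

Lemma all_cprod_sumn (I A : Type) (S : I -> seq A) (m : A -> nat) (n : I -> nat)
    (cs : seq I) :
  (forall c, List.In c cs -> all (fun x => m x == n c) (S c)) ->
  all (fun l => sumn (map m l) == sumn (map n cs)) (cprod (map S cs)).
Proof.
elim: cs => //= c cs IH mS; have {}IH := IH (fun c' h => mS c' (or_intror h)).
have := mS c (or_introl erefl); elim: (S c) => //= x s IHs /andP[/eqP mx /IHs].
rewrite all_cat => ->; rewrite andbT all_map; apply: sub_all IH => l /= /eqP->.
by rewrite mx.
Qed.

End Choices.

(** * Tree induction and rootward cuts *)

Lemma tree_nested_ind (P : tree -> Prop) :
  (forall cs, (forall c, List.In c cs -> P c) -> P (Node cs)) -> forall t, P t.
Proof.
move=> H; fix IH 1 => -[cs]; apply: H.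
elim: cs => [|c cs IHcs] x; first by case.
by case=> [<-|]; [apply: IH | apply: IHcs].
Qed.

(* The splittings of a tree into a subtree containing the root and the forest
   of the branches hanging below it. *)
Fixpoint cuts (t : tree) : seq (tree * forest) :=
  let: Node cs := t in
  [seq (Node (flatten (map fst l)), flatten (map snd l)) |
    l <- cprod [seq ([::], [:: c]) :: [seq ([:: rp.1], rp.2) | rp <- cuts c] | c <- cs]].

Definition cut_choices (c : tree) : seq (forest * forest) :=
  ([::], [:: c]) :: [seq ([:: rp.1], rp.2) | rp <- cuts c].

Lemma cutsE cs : cuts (Node cs) =
  [seq (Node (flatten (map fst l)), flatten (map snd l)) |
    l <- cprod (map cut_choices cs)].
Proof. by []. Qed.

Definition children (t : tree) : forest := let: Node cs := t in cs.

(** * The strict order polynomial and its linear coefficient *)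

Section OrderPolynomial.
Variables (k : fieldType) (hk : [pchar k] =i pred0).

(* The strict order polynomial: at a natural number n it counts the strictly
   monotone maps from the vertices of t to an n-element chain. *)
Fixpoint omega (t : tree) : {poly k} :=
  let: Node cs := t in sumop (\prod_(p <- map omega cs) p).
Definition omegaf (u : forest) : {poly k} := \prod_(c <- u) omega c.
Definition ell (t : tree) : k := (omega t)^`().[0].

Lemma omegaE cs : omega (Node cs) = sumop (omegaf cs).
Proof. by rewrite /omegaf -(big_map omega predT id). Qed.

Lemma omega_at0 t : (omega t).[0] = 0.
Proof. by case: t => cs; rewrite omegaE sumop_at0. Qed.

Lemma dif_omega t : dif (omega t) = omegaf (children t).
Proof. by case: t => cs; rewrite omegaE dif_sumop. Qed.

Lemma omegaf_flatten (A : Type) (f : A -> forest) (l : seq A) :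
  omegaf (flatten (map f l)) = \prod_(x <- l) omegaf (f x).
Proof. by rewrite /omegaf big_flatten big_map. Qed.

Lemma omegaf1 t : omegaf [:: t] = omega t.
Proof. exact: big_seq1. Qed.

Lemma omegaf0 : omegaf [::] = 1.
Proof. exact: big_nil. Qed.

Lemma omega_bullet : omega bullet = 'X.
Proof.
apply: (dif0_inj hk); last by rewrite omega_at0 hornerX.
by rewrite dif_omega omegaf0 /dif comp_polyX addrC addKr.
Qed.

Lemma ell_bullet : ell bullet = 1.
Proof. by rewrite /ell omega_bullet derivX hornerC. Qed.

Lemma size_polyM_le (p q : {poly k}) m n :
  (size p <= m.+1)%N -> (size q <= n.+1)%N -> (size (p * q)%R <= (m + n).+1)%N.
Proof.
move=> hp hq; apply: leq_trans (size_polyMleq _ _) _.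
by rewrite -subn1 leq_subLR add1n -addnS -addSn leq_add.
Qed.

Lemma size_omega t : (size (omega t) <= (nv t).+1)%N.
Proof.
elim/tree_nested_ind: t => cs IH; rewrite omegaE.
apply: leq_trans (size_sumop _) _; rewrite ltnS.
elim: cs IH => [|c cs IHcs] IH; first by rewrite omegaf0 size_poly1.
rewrite /omegaf big_cons; apply: size_polyM_le; first by apply: IH; left.
by apply: IHcs => c' h; apply: IH; right.
Qed.

Lemma size_omegaf u : (size (omegaf u) <= (nvf u).+1)%N.
Proof.
elim: u => [|t u IH]; first by rewrite omegaf0 size_poly1.
rewrite /omegaf big_cons; exact: size_polyM_le (size_omega t) IH.
Qed.

(* Monotone maps into a chain of length X + a, sorted by the rootward part of
   t that is mapped to the last X elements. *)
Lemma omega_vandermonde t (a : k) :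
  omega t \Po ('X + a%:P) =
    (omega t).[a]%:P + \sum_(rp <- cuts t) (omegaf rp.2).[a] *: omega rp.1.
Proof.
elim/tree_nested_ind: t => cs IH; apply: (dif0_inj hk); last first.
  rewrite horner_comp !hornerD hornerX !hornerC add0r [X in _ = _ + X]horner_sum.
  rewrite [X in _ = _ + X]big1 ?addr0 // => rp _.
  by rewrite hornerZ omega_at0 mulr0.
have -> p : dif (p \Po ('X + a%:P)) = dif p \Po ('X + a%:P) :> {poly k}.
  rewrite /dif rmorphB /= -!comp_polyA; congr (_ \Po _ - _).
  by rewrite !rmorphD /= !comp_polyX !rmorph1 comp_polyC; ring.
rewrite dif_omega difD difC add0r dif_sum cutsE big_map.
(* Applying [dif] replaces each rootward part by the product over its children, so the sum over cuts
   factors over the children of the root. *)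
under eq_bigr => l _ do rewrite difZ dif_omega /= !omegaf_flatten horner_prod
  -mul_polyC rmorph_prod -big_split /=.
rewrite big_cprod big_map [in LHS]/omegaf rmorph_prod /=; apply: eq_big_In => c c_cs.
rewrite IH // /cut_choices big_cons big_map /= omegaf1 omegaf0 mulr1.
by congr (_ + _); apply: eq_bigr => rp _; rewrite omegaf1 mul_polyC.
Qed.

(** Take the coefficient of ['X] in [omega_vandermonde]: on the left it is the derivative at [a],
    and [a] is arbitrary. *)
Lemma deriv_omega t :
  (omega t)^`() = \sum_(rp <- cuts t) (ell rp.1)%:P * omegaf rp.2.
Proof.
apply: (poly_inj_horner hk) => a.
have <- : (omega t \Po ('X + a%:P))^`().[0] = (omega t)^`().[a].
  rewrite deriv_comp derivD derivX derivC addr0 mulr1 horner_comp.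
  by rewrite hornerD hornerX hornerC add0r.
rewrite omega_vandermonde derivD derivC add0r linear_sum /= !horner_sum.
by apply: eq_bigr => rp _; rewrite derivZ hornerZ hornerM hornerC mulrC.
Qed.

(** The analogue of [omega] with integration in place of summation; its value at 1 is [Echar]. *)
Definition tree_exp (t : tree) : {poly k} := (tfact t)%:R^-1 *: 'X^(nv t).

Lemma deriv_tree_exp cs :
  (tree_exp (Node cs))^`() = \prod_(c <- cs) tree_exp c.
Proof.
rewrite /tree_exp derivZ derivXn /= -scaler_nat scalerA natrM invfM.
rewrite mulrAC mulVf ?(natr_neq0 hk) // mul1r.
elim: cs => [|c cs IH] /=; first by rewrite big_nil invr1 scale1r.
by rewrite big_cons -IH natrM invfM exprD -!mul_polyC rmorphM /=; ring.
Qed.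

Lemma tree_exp_at0 t : (tree_exp t).[0] = 0.
Proof. by case: t => cs; rewrite hornerZ hornerXn /= exprS mul0r mulr0. Qed.

(** The two lists differ at most by the root component. If no edge at the root is marked, [mtree A]
    is [bullet], where [ell] is 1. *)
Lemma prod_comps_true A :
  \prod_(c <- comps true A) ell c = ell (mtree A) * \prod_(c <- comps false A) ell c.
Proof.
case: A => l; rewrite /= big_cat /=; congr (_ * _).
case: (boolP (has fst l)) => hl; first by rewrite big_seq1.
rewrite big_nil -ell_bullet; congr (ell (Node _)).
by elim: l hl => //= -[[] d] l IH //= /IH.
Qed.

Definition edge_choices (c : tree) : seq (bool * btree) :=
  [seq (b, d) | b <- [:: true; false], d <- edecs c].

Lemma edecsE cs : edecs (Node cs) = map BNode (cprod (map edge_choices cs)).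
Proof. by []. Qed.

Lemma sum_edge_choices c (F : bool * btree -> {poly k}) :
  \sum_(x <- edge_choices c) F x =
  \sum_(d <- edecs c) F (true, d) + \sum_(d <- edecs c) F (false, d).
Proof. by rewrite big_allpairs_dep big_cons big_seq1. Qed.

(* The two sides have the same derivative, the contraction by s being sorted
   by the component of s at the root. *)
Lemma omega_contraction t :
  (forall F : tree -> {poly k},
    \sum_(A <- edecs t) F (mtree A) *
       ((\prod_(c <- comps false A) ell c)%:P * \prod_(c <- contk A) tree_exp c) =
    \sum_(rp <- cuts t) F rp.1 * omegaf rp.2) /\
  \sum_(A <- edecs t) (\prod_(c <- subforest A) ell c)%:P * tree_exp (quot A)
    = omega t.
Proof.
elim/tree_nested_ind: t => cs IH.
set claim1 := (X in X /\ _); have c1 : claim1.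
  rewrite /claim1.
  move=> F; rewrite edecsE cutsE !big_map.
  pose f (x : bool * btree) := if x.1 then [:: mtree x.2] else [::].
  pose g (x : bool * btree) := (\prod_(c <- comps (~~ x.1) x.2) ell c)%:P *
    \prod_(c <- if x.1 then contk x.2 else [:: Node (contk x.2)]) tree_exp c.
  transitivity (\sum_(l <- cprod (map edge_choices cs))
      F (Node (flatten (map f l))) * \prod_(x <- l) g x).
    apply: eq_bigr => l _; rewrite /= !big_flatten !big_map.
    by rewrite rmorph_prod -big_split.
  transitivity (\sum_(l <- cprod (map cut_choices cs))
      F (Node (flatten (map fst l))) * \prod_(y <- l) omegaf y.2); last first.
    by apply: eq_bigr => l _; rewrite omegaf_flatten.
  (* At each child, a marked edge matches keeping part of the branch (first claim for the child), an
     unmarked one matches cutting it off (second claim). *)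
  apply: (cprod_transfer _ (fun z => F (Node z))) => c c_cs G.
  have [IH1 IH2] := IH c c_cs.
  rewrite sum_edge_choices /cut_choices big_cons big_map /= addrC; congr (_ + _).
    rewrite omegaf1 -IH2 mulr_sumr; apply: eq_bigr => d _.
    by rewrite /f /g /= big_seq1.
  rewrite -(IH1 (fun t => G [:: t])); apply: eq_bigr => d _.
  by rewrite /f /g.
split=> //; apply: (deriv_inj hk).
  (* Taking [ell] for [F] turns the first claim into the derivative of the second, the root
     component supplying the factor [ell rp.1]. *)
  rewrite deriv_omega -(c1 (fun r => (ell r)%:P)) linear_sum /=; apply: eq_bigr => A _.
  rewrite derivM derivC mul0r add0r deriv_tree_exp prod_comps_true rmorphM.
  by rewrite mulrA.
rewrite omega_at0 [LHS]horner_sum; apply: big1 => A _.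
by rewrite hornerM tree_exp_at0 mulr0.
Qed.

(** * The full edge set and the antipode recursion *)

Fixpoint all_marked (t : tree) : btree :=
  let: Node cs := t in BNode [seq (true, all_marked c) | c <- cs].

Lemma filter_full_edecs t : filter full (edecs t) = [:: all_marked t].
Proof.
elim/tree_nested_ind: t => cs IH; rewrite edecsE filter_map.
rewrite (eq_filter (a2 := all (fun bc : bool * btree => bc.1 && full bc.2))) //.
rewrite filter_all_cprod -map_comp.
suff -> : map (filter (fun bc => bc.1 && full bc.2) \o edge_choices) cs
   = [seq [:: (true, all_marked c)] | c <- cs] by rewrite cprod_seq1.
elim: cs IH => //= c cs IHcs IH; congr (_ :: _).
  rewrite filter_cat filter_map.
  rewrite (eq_filter (a2 := full)) // (IH c) /=; last by left.
  rewrite cats0 filter_map (eq_filter (a2 := pred0)) // filter_pred0 //.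
by apply: IHcs => c' h; apply: IH; right.
Qed.

Lemma mtree_all_marked t : mtree (all_marked t) = t.
Proof.
elim/tree_nested_ind: t => cs IH /=; congr Node.
elim: cs IH => //= c cs IHcs IH; rewrite IH; last by left.
by congr (_ :: _); apply: IHcs => c' h; apply: IH; right.
Qed.

Lemma comps_all_marked t : comps false (all_marked t) = [::].
Proof.
elim/tree_nested_ind: t => cs IH /=.
elim: cs IH => //= c cs IHcs IH; rewrite IH; last by left.
by apply: IHcs => c' h; apply: IH; right.
Qed.

Lemma contk_nilp A : nilp (contk A) = full A.
Proof.
move: A; fix IH 1 => -[l] /=; elim: l => //= -[b d] l IHl /=.
by rewrite -IHl -IH /nilp size_cat; case: b => //=; rewrite addn_eq0.
Qed.

Fixpoint nvb (A : btree) : nat :=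
  let: BNode l := A in (sumn [seq nvb bc.2 | bc <- l]).+1.

Lemma nvb_edecs t : all (fun A => nvb A == nv t) (edecs t).
Proof.
elim/tree_nested_ind: t => cs IH; rewrite edecsE all_map.
apply: sub_all (all_cprod_sumn (m := fun bc => nvb bc.2) (n := nv)
  (S := edge_choices) (cs := cs) _) => [l /= /eqP -> //|c /IH].
by rewrite /edge_choices /= cats0 all_cat !all_map /= => h; apply/andP.
Qed.

(** The boolean makes the bound strict when some edge is unmarked, since a vertex is then left out
    of the root component. *)
Lemma nv_mtree A : (nv (mtree A) + ~~ full A <= nvb A)%N.
Proof.
move: A; fix IH 1 => -[l] /=; rewrite addSn ltnS.
elim: l => //= -[b d] l IHl /=; rewrite map_cat sumn_cat.
have := IH d; case: b => /=; last first.
  case: d {IH} => l' /= _; rewrite add0n addnC.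
  by apply: leq_add => //; apply: leq_trans IHl; apply: leq_addr.
rewrite addn0; case: (full d) => /= hd; last first.
  rewrite -addnA [X in (_ + X)%N]addnC addnA.
  by apply: leq_add => //; apply: leq_trans IHl; apply: leq_addr.
by rewrite -addnA; apply: leq_add => //; rewrite addn0 in hd.
Qed.

(** Only the root component can contain every vertex, and only if all edges are marked. This makes
    the fuel of [Lf] suffice. *)
Lemma nv_comps top A :
  all (fun c => nv c + ~~ (top && full A) <= nvb A)%N (comps top A).
Proof.
move: top A; fix IH 2 => top [l].
have sub : all (fun c => nv c < nvb (BNode l))%N
    (flatten [seq comps (~~ bc.1) bc.2 | bc <- l]).
  rewrite /=; elim: l => //= -[b d] l IHl /=; rewrite all_cat; apply/andP; split.
    apply: sub_all (IH (~~ b) d) => c hc; rewrite ltnS.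
    apply: leq_trans (leq_addr _ _); exact: leq_trans (leq_addr _ _) hc.
  by apply: sub_all IHl => c hc; apply: leq_trans hc _; rewrite ltnS leq_addl.
rewrite [comps _ _]/=  all_cat; apply/andP; split.
  by case: top => //; case: (has fst l) => //=; rewrite andbT; apply: nv_mtree (BNode l).
apply: sub_all sub => c hc; case: (top && _) => /=; rewrite ?addn0 ?addn1 //.
exact: ltnW.
Qed.

Lemma edecs_sum_full t (F : btree -> k) :
  \sum_(A <- edecs t | full A) F A = F (all_marked t).
Proof. by rewrite -big_filter filter_full_edecs big_seq1. Qed.

Lemma contk_all_marked t : contk (all_marked t) = [::].
Proof.
apply/nilP; rewrite contk_nilp.
have : all full (filter full (edecs t)) by apply: filter_all.
by rewrite filter_full_edecs /= andbT.
Qed.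

Lemma prod_all_marked t : \prod_(c <- subforest (all_marked t)) ell c = ell t.
Proof.
by rewrite /subforest prod_comps_true comps_all_marked big_nil mulr1 mtree_all_marked.
Qed.

(** Evaluate the contraction identity at 1, where [tree_exp] becomes [Echar] and the full edge set
    contributes exactly [ell t]. *)
Lemma ell_recursion t : nedges t != 0%N ->
  ell t = - \sum_(A <- edecs t | ~~ full A)
     (\prod_(c <- subforest A) ell c) * Echar k (quot A).
Proof.
move=> nt; apply/eqP; rewrite -addr_eq0; apply/eqP.
have [_ /(congr1 (fun p => p.[1]))] := omega_contraction t.
(* The value at 1 is the difference at 0, a product over the children; as [t] has an edge, some
   factor is present and vanishes at 0. *)
have -> : (omega t).[1] = 0.
  have := congr1 (fun p => p.[0]) (dif_omega t).
  rewrite /= horner_dif omega_at0 subr0 add0r => ->.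
  case: t nt => -[|c cs] //= _.
  by rewrite /omegaf big_cons hornerM omega_at0 mul0r.
rewrite horner_sum (bigID full) /= edecs_sum_full /quot contk_all_marked.
rewrite prod_all_marked => sum0; rewrite -[RHS]sum0; congr (_ + _).
  by rewrite hornerM hornerC hornerZ hornerXn expr1n invr1 !mulr1.
apply: eq_bigr => A _.
by rewrite hornerM hornerC hornerZ hornerXn expr1n mulr1.
Qed.

Lemma Lf_ell n t : (nv t <= n)%N -> Lf k n t = ell t.
Proof.
elim: n t => [|n IH] t nt; first by case: t nt.
rewrite /=; case: eqP => [t0|/eqP t0].
  case: t nt t0 => -[|[cs'] cs] //= _ _; exact/esym/ell_bullet.
rewrite ell_recursion //; congr (- _).
apply: eq_big_all (nvb_edecs t) _ => A /eqP nA fA; congr (_ * _).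
have := nv_comps true A; rewrite fA nA -/(subforest A).
elim: (subforest A) => [|c s IHs]; first by rewrite !big_nil.
rewrite !big_cons /= addn1 => /andP[hc hs]; rewrite IHs // IH //.
by rewrite -ltnS (leq_trans hc).
Qed.

Lemma Lchar_ell t : Lchar k t = ell t.
Proof. exact: Lf_ell. Qed.

(** [delta_bullet] keeps only the contraction to a single vertex, which comes from the full edge set
    alone. *)
Lemma sum_L_full t :
  \sum_(A <- edecs t) (\prod_(c <- subforest A) Lchar k c)
     * delta_bullet k [:: quot A] = ell t.
Proof.
rewrite (bigID full) /= [X in _ + X]big1 ?addr0 => [|A fA].
  rewrite edecs_sum_full /quot contk_all_marked mulr1 -prod_all_marked.
  by apply: eq_bigr => c _; apply: Lchar_ell.
by move: fA; rewrite -contk_nilp /quot; case: (contk A) => //; rewrite mulr0.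
Qed.

Lemma L_star_delta_bulletE u : L_star_delta_bullet k u = (omegaf u)^`().[0].
Proof.
rewrite /L_star_delta_bullet; case: u => [|t [|t' u]].
- by rewrite big_seq1 omegaf0 derivC horner0 mulr0.
- rewrite big_allpairs_dep omegaf1 -/(ell t) -sum_L_full.
  by apply: eq_bigr => A _; rewrite !big_seq1.
(* With two or more trees, every Leibniz term keeps an [omega] factor vanishing at 0, and
   [delta_bullet] kills the other side. *)
rewrite /omegaf !big_cons !derivM !(hornerM, hornerD) !omega_at0.
rewrite !(mul0r, mulr0, addr0) big_allpairs_dep big1 // => A _.
rewrite big_allpairs_dep big1 // => A' _; rewrite big1 // => l _ /=.
by rewrite /quot; case: (contk A); rewrite mulr0.
Qed.

End OrderPolynomial.

(** * Vertex decompositions with every vertex in V *)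

Fixpoint vall (t : tree) : vtree := let: Node cs := t in VNode true (map vall cs).

Lemma vmark_vall t : vmark (vall t) = true.
Proof. by case: t. Qed.

Lemma kidsV_vall cs : kidsV true (vall (Node cs)) = cs.
Proof.
suff kid t : Node (kidsV true (vall t)) = t by case: (kid (Node cs)).
elim/tree_nested_ind: t => cs' IH /=; congr Node.
elim: cs' IH => //= c cs' IHcs IH; rewrite vmark_vall eqxx IH /=; last by left.
by congr (_ :: _); apply: IHcs => c' h; apply: IH; right.
Qed.

(** Two cases are covered: W is empty ([p] false), or the vertex continues a tree already opened
    above it ([top] false). *)
Lemma indf_vall_nil p top t : ~~ (top && p) -> indf p top (vall t) = [::].
Proof.
elim/tree_nested_ind: t top => cs IH top /=; rewrite eq_sym eqb_id => /negbTE->.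
have : ~~ ((true != p) && p) by case: p {IH}.
elim: cs IH => //= c cs IHcs IH tp; rewrite IH //=; last by left.
by apply: IHcs => // c' h; apply: IH; right.
Qed.

Lemma flatten_vall_nil p top cs : ~~ (top && p) ->
  flatten [seq indf p top c | c <- map vall cs] = [::].
Proof. by move=> tp; elim: cs => //= c cs ->; rewrite indf_vall_nil. Qed.

Lemma indf_vall t : indf true true (vall t) = [:: t].
Proof.
case: t => cs.
transitivity ([:: Node (kidsV true (vall (Node cs)))] ++
  flatten [seq indf true false c | c <- map vall cs]); first by [].
by rewrite flatten_vall_nil // kidsV_vall.
Qed.

Lemma flatten_vall cs : flatten [seq indf true true c | c <- map vall cs] = cs.
Proof. by elim: cs => //= c cs ->; rewrite indf_vall. Qed.

Lemma allin_adm D : allin true D = adm D && vmark D.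
Proof.
move: D; fix IH 1 => -[b l] /=; case: b => /=; last by rewrite andbF.
rewrite andbT.
suff : all (allin true) l -> all adm l by case: all => //= ->.
by elim: l => //= D l IHl /andP[]; rewrite IH => /andP[-> _] /IHl.
Qed.

Lemma vdecsE cs : vdecs (Node cs) =
  [seq VNode b l | b <- [:: true; false], l <- cprod (map vdecs cs)].
Proof. by []. Qed.

Lemma filter_all_allin (ss : seq (seq vtree)) (cs : seq tree) :
  map (filter (allin true)) ss = [seq [:: vall c] | c <- cs] ->
  filter (all (allin true)) (cprod ss) = [:: map vall cs].
Proof. by rewrite filter_all_cprod => ->; apply: cprod_seq1. Qed.

Lemma filter_allin_vdecs t : filter (allin true) (vdecs t) = [:: vall t].
Proof.
elim/tree_nested_ind: t => cs IH; rewrite vdecsE /= cats0 filter_cat !filter_map.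
rewrite (eq_filter (a2 := all (allin true))) //.
rewrite (filter_all_allin (cs := cs)) ?(eq_filter (a2 := pred0)) ?filter_pred0 //.
elim: cs IH => //= c cs IHcs IH; rewrite IH /=; last by left.
by congr (_ :: _); apply: IHcs => c' h; apply: IH; right.
Qed.

Lemma filter_allin_cprod cs :
  filter (all (allin true)) (cprod (map vdecs cs)) = [:: map vall cs].
Proof.
apply: filter_all_allin; rewrite -map_comp.
by apply: eq_map => c; apply: filter_allin_vdecs.
Qed.

(** * Convolution powers and the logarithm *)

Section Logarithm.
Variables (k : fieldType) (hk : [pchar k] =i pred0).

(* Interpolates between the counit (x = 0) and deltaCK (x = 1). *)
Definition delta_at (x : k) (c : tree) : k := x * (is_bullet c)%:R.

Lemma prod_delta_at0 u : \prod_(c <- u) delta_at 0 c = epsCK k u.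
Proof. by case: u => [|c u]; rewrite ?big_nil // big_cons /delta_at !mul0r. Qed.

Lemma prod_delta_at1 u : \prod_(c <- u) delta_at 1 c = deltaCK k u.
Proof.
rewrite /deltaCK; elim: u => [|c u IH]; first by rewrite big_nil.
by rewrite big_cons IH /delta_at mul1r /= -natrM mulnb.
Qed.

(** An admissible W is empty or a single tree containing the root. The first term is W empty;
    otherwise [delta_at] forces W to be the root alone, which leaves the children in V. *)
Lemma vdecs_adm_sum t (x : k) :
  \sum_(D <- vdecs t | adm D) omegaf k (indf true true D) *
     (\prod_(c <- indf false true D) delta_at x c)%:P
  = omega k t + omegaf k (children t) * x%:P.
Proof.
case: t => cs; rewrite vdecsE big_cat /= cats0.
congr (_ + _); rewrite [LHS]big_map.
  rewrite (eq_bigl (all (allin true))) => [|l]; last first.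
    by have /= := allin_adm (VNode true l); rewrite andbT => <-.
  rewrite -big_filter filter_allin_cprod big_seq1.
  have -> : indf false true (VNode true (map vall cs)) = [::].
    exact: (flatten_vall_nil (p := false)).
  by rewrite -[VNode _ _]/(vall (Node cs)) indf_vall omegaf1 big_nil mulr1.
have kids l : is_bullet (Node (kidsV false (VNode false l))) = all vmark l.
  by rewrite /=; elim: l => //= D l IHl; case: (vmark D).
rewrite (bigID (all vmark)) /= [X in _ + X]big1 ?addr0; last first.
  move=> l /andP[_ /negPf ml]; rewrite big_cons /delta_at.
  by rewrite -[Node _]/(Node (kidsV false (VNode false l))) kids ml mulr0 mul0r mulr0.
rewrite (eq_bigl (all (allin true))) => [|l]; last first.
  by rewrite -all_predI; apply: eq_all => D; rewrite allin_adm.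
rewrite -big_filter filter_allin_cprod big_seq1 flatten_vall.
rewrite flatten_vall_nil // big_seq1 /delta_at.
rewrite -[Node _]/(Node (kidsV false (VNode false (map vall cs)))) kids.
have -> : all vmark (map vall cs) by elim: cs => //= c cs ->; rewrite vmark_vall.
by rewrite mulr1.
Qed.

(** The sum over decompositions factors over the trees of [u]. By [dif_omega], the factors are
    translates of [omega k t] by 1 at [x = 1], and [omega k t] itself at [x = 0]. *)
Lemma convCK_delta_at (lam : {scalar {poly k}}) (x : k) u :
  convCK (fun v => lam (omegaf k v)) (fun w => \prod_(c <- w) delta_at x c) u
  = lam (\prod_(t <- u) (omega k t + omegaf k (children t) * x%:P)).
Proof.
rewrite /convCK -[LHS]big_filter filter_all_cprod -map_comp.
transitivity (lam (\sum_(Ds <- cprod (map (filter adm \o vdecs) u))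
    \prod_(D <- Ds) (omegaf k (indf true true D) *
      (\prod_(c <- indf false true D) delta_at x c)%:P))).
  rewrite linear_sum; apply: eq_bigr => Ds _.
  rewrite omegaf_flatten big_flatten big_map big_split -rmorph_prod /=.
  by rewrite [in RHS]mulrC mul_polyC linearZ /= mulrC.
rewrite big_cprod big_map; congr (lam _); apply: eq_bigr => t _.
by rewrite -vdecs_adm_sum /= big_filter.
Qed.

(** Packaged as a linear form, hence the codomain [k^o], to serve as [lam] in [convCK_delta_at]. *)
Definition iter_dif_at0 n (p : {poly k}) : k^o := (iter n (@dif k) p).[0].

Lemma iter_dif_at0_is_linear n : linear (iter_dif_at0 n).
Proof.
move=> a p q; rewrite /iter_dif_at0.
suff -> : iter n (@dif k) (a *: p + q) = a *: iter n (@dif k) p + iter n (@dif k) q.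
  by rewrite hornerD hornerZ.
by elim: n => //= n ->; rewrite difD difZ.
Qed.
HB.instance Definition _ n :=
  GRing.isLinear.Build k {poly k} k^o _ (iter_dif_at0 n) (iter_dif_at0_is_linear n).

(** Convolution with [deltaCK - epsCK] subtracts the case [x = 0] from the case [x = 1]: translation
    minus identity, that is one more [dif]. *)
Lemma cpow_delta n u :
  cpow (fun v => deltaCK k v - epsCK k v) n u = iter_dif_at0 n (omegaf k u).
Proof.
elim: n u => [|n IH] u.
  rewrite /iter_dif_at0 /=; case: u => [|t u]; first by rewrite omegaf0 hornerC.
  by rewrite /omegaf big_cons hornerM omega_at0 mul0r.
have conv x := convCK_delta_at (iter_dif_at0 n) x u.
transitivity (iter_dif_at0 n (\prod_(t <- u) (omega k t + omegaf k (children t) * 1%:P))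
  - iter_dif_at0 n (\prod_(t <- u) (omega k t + omegaf k (children t) * 0%:P))).
  rewrite -!conv /= /convCK -sumrB; apply: eq_bigr => D _.
  by rewrite IH -mulrBr prod_delta_at0 prod_delta_at1.
rewrite -linearB /= /iter_dif_at0 iterSr; congr (iter n _ _).[_].
rewrite /dif /omegaf rmorph_prod /=; congr (_ - _); apply: eq_bigr => t _.
  by rewrite mulr1 -/(omegaf k _) -(dif_omega hk) /dif addrC subrK.
by rewrite mulr0 addr0.
Qed.

(** The degree of [omegaf k u] is at most [nvf u], so [N] terms exhaust the logarithm series. *)
Lemma log_delta_partialE u N :
  (nvf u <= N)%N -> log_delta_partial k N u = (omegaf k u)^`().[0].
Proof.
move=> uN; rewrite (deriv0_log_dif hk (N := N)); last first.
  exact: leq_trans (size_omegaf k u) _.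
by apply: eq_bigr => n _; rewrite cpow_delta.
Qed.

End Logarithm.

(* L * delta_bullet = log^* delta on every forest u (a basis of H_CK);
   the locally finite series is represented by its partial sums, which
   are claimed to equal the left side as soon as N >= #vertices of u. *)
Theorem mainTheorem11 (k : fieldType) (hk : [pchar k] =i pred0)
    (u : forest) (N : nat) :
  (nvf u <= N)%N ->
  L_star_delta_bullet k u = log_delta_partial k N u.
Proof.
by move=> uN; rewrite log_delta_partialE // L_star_delta_bulletE.
Qed.
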